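(* Let $G$ be a distance-hereditary graph, let $x,y$ be a diametral pair of vertices of $G$ (i.e. $d_G(x,y)=\operatorname{diam}(G)$), and let $k$ be the minimum eccentricity of a shortest path in $G$ (the minimum of $\operatorname{ecc}(P)$ over all shortest paths $P$ of $G$). Then there is a shortest path $P$ between $x$ and $y$ with $\operatorname{ecc}(P)=k$.
   Context: All graphs are finite, connected, unweighted, undirected, without loops or multiple edges. $d_G(u,v)$ is the length (number of edges) of a shortest $u$–$v$ path; for $S\subseteq V$, $d_G(v,S)=\min_{u\in S}d_G(u,v)$, and the eccentricity of a vertex set (or path) $S$ is $\operatorname{ecc}(S)=\max_{u\in V}d_G(u,S)$. $\operatorname{diam}(G)=\max_{u,v}d_G(u,v)$. A graph is distance-hereditary if distances in every connected induced subgraph equal the distances in $G$ (equivalently, every induced path is a shortest path). *)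

(* Defs.v *)
From mathcomp Require Import all_boot.

Set Implicit Arguments.
Unset Strict Implicit.
Unset Printing Implicit Defensive.

Section Graph.
Variables (T : finType) (e : rel T).

Definition simple_graph : Prop := symmetric e /\ irreflexive e.

Definition connected_graph : Prop := forall u v : T, connect e u v.

(* A path with vertices u :: p, i.e. with size p edges, from u to v. *)
Definition upath (u v : T) (p : seq T) : bool :=
  [&& path e u p, last u p == v & uniq (u :: p)].

(* Least number of edges of a u-v path. The search is bounded by #|T| because
   the vertices of a path are distinct; the value is #|T| if v is not reachable
   from u (see upath_distP and dist_le). *)
Definition dist (u v : T) : nat :=
  find (fun n => [exists p : n.-tuple T, upath u v p]) (iota 0 #|T|).

(* Every distance in a connected graph is smaller than #|T|, so the default
   value #|T| of the minimum is only returned for S = set0. *)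
Definition dist_set (v : T) (S : {set T}) : nat :=
  \big[minn/#|T|]_(u in S) dist u v.

Definition ecc (S : {set T}) : nat := \max_(u : T) dist_set u S.

Definition diam : nat := \max_(u : T) \max_(v : T) dist u v.

Definition diametral (x y : T) : Prop := dist x y = diam.

Definition shortest_path (u v : T) (p : seq T) : bool :=
  upath u v p && (size p == dist u v).

(* Eccentricity of the path with vertices u :: p. *)
Definition path_ecc (u : T) (p : seq T) : nat := ecc [set z in u :: p].

Definition min_shortest_path_ecc (k : nat) : Prop :=
  (exists u v p, shortest_path u v p /\ path_ecc u p = k) /\
  (forall u v p, shortest_path u v p -> k <= path_ecc u p).

End Graph.

Definition induced (T : finType) (e : rel T) (S : {set T}) :
  rel {x : T | x \in S} := fun a b => e (val a) (val b).

Definition distance_hereditary (T : finType) (e : rel T) : Prop :=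
  forall S : {set T}, connected_graph (induced e (S := S)) ->
  forall a b : {x : T | x \in S},
    dist (induced e (S := S)) a b = dist e (val a) (val b).

Lemma upath_size (T : finType) (e : rel T) u v p : upath e u v p -> size p < #|T|.
Proof. by case/and3P=> _ _ /card_uniqP /= <-; apply: max_card. Qed.

Lemma dist_le (T : finType) (e : rel T) u v p : upath e u v p -> dist e u v <= size p.
Proof.
move=> up; have lt_p := upath_size up; rewrite leqNgt; apply/negP => /(before_find 0).
rewrite nth_iota // add0n => /existsP[].
by exists (in_tuple p).
Qed.

Lemma upath_distP (T : finType) (e : rel T) u v :
  connect e u v -> exists2 p, upath e u v p & size p = dist e u v.
Proof.
case/connectP=> p0 /shortenP[p ep Up _] Dv.
have up : upath e u v p by rewrite /upath ep Dv eqxx.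
set P := fun n => [exists p : n.-tuple T, upath e u v p].
have hasP : has P (iota 0 #|T|).
  apply/hasP; exists (size p); first by rewrite mem_iota /= add0n (upath_size up).
  by apply/existsP; exists (in_tuple p).
have := nth_find 0 hasP; rewrite nth_iota; last by move: hasP; rewrite has_find size_iota.
by rewrite add0n => /existsP[q uq]; exists q; rewrite ?size_tuple.
Qed.

(* Main.v *)
Require Import Defs.
From mathcomp Require Import all_boot zify.

Set Implicit Arguments.
Unset Strict Implicit.
Unset Printing Implicit Defensive.

(* Distances in a distance-hereditary graph satisfy a four-point condition: two of
   the three sums d(u,v) + d(w,z), d(u,w) + d(v,z), d(u,z) + d(v,w) are equal and
   the third exceeds them by at most 2. The rest of the argument is metric.

   Call A_x = d(x,y) + d(x,z) - d(y,z) twice the leg of x in the triple x, y, z. If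
   a geodesic Q has eccentricity at most k and all three legs are at least k, then
   one leg equals k and some vertex of Q is a center of the triple, i.e. lies at
   exactly the legs' distances. Applied to a diametral pair x, y and a vertex v:
   the leg of v is at most k, and the distance from v to any choice of one vertex
   in each slice of the interval I(x,y) is at most k, except possibly when v has
   leg k; then the vertex chosen in the slice of the center must be a center. For
   the vertices v with leg k whose centers lie in a fixed slice, the sets of
   centers on Q form a chain under inclusion, so one vertex of that slice serves
   them all. Any choice of one vertex per slice is a shortest path from x to y. *)

Definition four_point (s1 s2 s3 : nat) : Prop :=
  s1 = s2 /\ s3 <= s1 + 2 \/ s1 = s3 /\ s2 <= s1 + 2 \/ s2 = s3 /\ s1 <= s2 + 2.

(* The metric of a connected graph on four vertices: each distance is 1 or is
   realized by a first step to a third vertex. *)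
Lemma four_point_four_vertices (uv uw ux vw vx wx : nat) :
  uv > 0 -> uw > 0 -> ux > 0 -> vw > 0 -> vx > 0 -> wx > 0 ->
  uv = 1 \/ uw = 1 /\ uv = vw + 1 \/ ux = 1 /\ uv = vx + 1 ->
  uw = 1 \/ uv = 1 /\ uw = vw + 1 \/ ux = 1 /\ uw = wx + 1 ->
  ux = 1 \/ uv = 1 /\ ux = vx + 1 \/ uw = 1 /\ ux = wx + 1 ->
  vw = 1 \/ uv = 1 /\ vw = uw + 1 \/ vx = 1 /\ vw = wx + 1 ->
  vx = 1 \/ uv = 1 /\ vx = ux + 1 \/ vw = 1 /\ vx = wx + 1 ->
  wx = 1 \/ uw = 1 /\ wx = ux + 1 \/ vw = 1 /\ wx = vx + 1 ->
  uv <= uw + vw -> uv <= ux + vx -> uw <= uv + vw -> uw <= ux + wx ->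
  ux <= uv + vx -> ux <= uw + wx -> vw <= uv + uw -> vw <= vx + wx ->
  vx <= uv + ux -> vx <= vw + wx -> wx <= uw + ux -> wx <= vw + vx ->
  four_point (uv + wx) (uw + vx) (ux + vw).
Proof.
rewrite /four_point => ? ? ? ? ? ? UV UW UX VW VX WX.
do 12!move=> ?.
case: UV => UV; case: WX => WX; case: UW => UW; try lia.
all: by case: VX => VX; case: UX => UX; case: VW => VW; lia.
Qed.

(** * The four-point condition in distance-hereditary graphs *)

Section Distance.
Variables (T : finType) (e : rel T).
Hypotheses (e_sym : symmetric e) (e_conn : connected_graph e).

Lemma dist_walk u p : path e u p -> dist e u (last u p) <= size p.
Proof.
move=> ep; case/shortenP: (ep) => p' ep' Up' sub_p.
apply: (@leq_trans (size p')); last by apply: uniq_leq_size sub_p; case/andP: Up'.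
by apply: dist_le; rewrite /upath ep' eqxx.
Qed.

Lemma dist_geodesic u v : exists p, [/\ path e u p, last u p = v & size p = dist e u v].
Proof.
by have [p /and3P[ep /eqP lp _] sp] := upath_distP (e_conn u v); exists p.
Qed.

Lemma dist_refl u : dist e u u = 0.
Proof. by apply/eqP; rewrite -leqn0; apply: (@dist_walk u [::]). Qed.

Lemma dist_eq0 u v : dist e u v = 0 -> u = v.
Proof. by have [p [_ <- <-]] := dist_geodesic u v; move/size0nil->. Qed.

Lemma dist_sym u v : dist e u v = dist e v u.
Proof.
have le_dist a b : dist e a b <= dist e b a.
  have [p [ep lp <-]] := dist_geodesic b a.
  have : path e (last b p) (rev (belast b p)).
    by rewrite rev_path (eq_path (e' := e)) // => c c'; rewrite e_sym.
  move/dist_walk; rewrite size_rev size_belast lp.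
  by case: p {ep} lp => [|c p] /= <-; rewrite ?rev_cons ?last_rcons.
by apply/eqP; rewrite eqn_leq !le_dist.
Qed.

Lemma dist_triangle u v w : dist e u w <= dist e u v + dist e v w.
Proof.
have [p [ep lp <-]] := dist_geodesic u v; have [q [eq lq <-]] := dist_geodesic v w.
have := @dist_walk u (p ++ q); rewrite cat_path ep lp eq last_cat lp lq size_cat.
exact.
Qed.

Lemma dist_edge u v : e u v -> dist e u v <= 1.
Proof. by move=> uv; apply: (@dist_walk u [:: v]); rewrite /= uv. Qed.

Lemma edge_dist1 u v : dist e u v = 1 -> e u v.
Proof.
have [p [ep <- <-]] := dist_geodesic u v.
by case: p ep => [|c [|]] //=; rewrite andbT.
Qed.

Lemma dist_between u v i :
  i <= dist e u v -> exists2 c, dist e u c = i & dist e c v = dist e u v - i.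
Proof.
have [p [ep lp sp]] := dist_geodesic u v; rewrite -sp => le_ip.
have lt_u : dist e u (last u (take i p)) <= i.
  by rewrite -[leqRHS](size_takel le_ip) dist_walk // take_path.
have lt_v : dist e (last u (take i p)) v <= size p - i.
  rewrite -size_drop -lp -{2}(cat_take_drop i p) last_cat; apply: dist_walk.
  by move: ep; rewrite -{1}(cat_take_drop i p) cat_path => /andP[].
have := dist_triangle u (last u (take i p)) v.
exists (last u (take i p)); lia.
Qed.

(** Unlike [induced], this relation stays on [T], so shrinking [S] does not change the type of the
    vertices. *)
Definition within (S : {set T}) : rel T := fun a b => [&& e a b, a \in S & b \in S].

Definition connected_set (S : {set T}) : Prop := {in S &, forall a b, connect (within S) a b}.

Lemma connected_setT : connected_set setT.
Proof.
move=> a b _ _; apply: connect_sub (e_conn a b) => c c' cc'.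
by apply: connect1; rewrite /within cc' !inE.
Qed.

Lemma connected_set_induced S : connected_set S -> connected_graph (induced e (S := S)).
Proof.
move=> cS a b; have /connectP[p] := cS _ _ (valP a) (valP b).
elim: p a => [|c p IHp] a /=; first by move=> _ /val_inj->.
case/andP=> /and3P[ac _ Sc] pc lp.
by apply: connect_trans (IHp (Sub c Sc) pc lp); apply: connect1.
Qed.

Definition component (S : {set T}) (u : T) : {set T} := [set a | connect (within S) u a].

Lemma within_sym S : symmetric (within S).
Proof. by move=> a b; rewrite /within e_sym [(a \in S) && _]andbC. Qed.

Lemma connected_component S u : connected_set (component S u).
Proof.
have from_u a : connect (within S) u a -> connect (within (component S u)) u a.
  case/connectP=> p; elim/last_ind: p a => [|p c IHp] a /=; first by move=> _ ->.
  rewrite rcons_path last_rcons => /andP[pp lc] ->.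
  apply: connect_trans (IHp _ pp erefl) (connect1 _).
  have up : connect (within S) u (last u p) by apply/connectP; exists p.
  rewrite /within !inE up (connect_trans up (connect1 lc)) !andbT.
  by case/and3P: lc.
move=> a b; rewrite !inE => /from_u ua /from_u ub.
by apply: connect_trans ub; rewrite (sym_connect_sym (@within_sym _)).
Qed.

Lemma component_sub (S : {set T}) u : u \in S -> {subset component S u <= S}.
Proof.
move=> Su a; rewrite inE => /connectP[p].
elim/last_ind: p a => [|p c _] a /=; first by move=> _ ->.
by rewrite rcons_path last_rcons => /andP[_ /and3P[_ _ Sc]] ->.
Qed.

Hypothesis e_dh : distance_hereditary e.

(** A shortest path inside [S] has length [dist e a b] by heredity, so its second vertex is one step
    closer to [b] in the whole graph too. Heredity enters the argument only here. *)
Lemma dist_step (S : {set T}) a b : connected_set S -> a \in S -> b \in S -> a != b ->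
  exists c, [/\ c \in S, e a c & dist e a b = (dist e c b).+1].
Proof.
move=> cS Sa Sb neq_ab; have cI := connected_set_induced cS.
have [p /and3P[pp /eqP lp _]] := upath_distP (cI (Sub a Sa) (Sub b Sb)).
rewrite (e_dh cI) /=; case: p pp lp => [|c p] /=.
  by move=> _ /(congr1 val) /= ab; rewrite ab eqxx in neq_ab.
case/andP=> ac pc lp sp; exists (val c); split; [exact: valP | exact: ac |].
apply/eqP; rewrite eqn_leq; apply/andP; split.
  by apply: leq_trans (dist_triangle _ (val c) _) _; rewrite -add1n leq_add2r dist_edge.
rewrite -sp ltnS -(size_map val) (_ : b = last (val c) (map val p)); last first.
  by rewrite last_map lp.
by apply: dist_walk; rewrite path_map.
Qed.

(** Each step given by [dist_step] from the component stays in it or hits [s], so some geodesic from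
    [a] to [b] passes through [s]. *)
Lemma dist_cut (S : {set T}) s u a b : connected_set S -> u \in S :\ s ->
  a \in component (S :\ s) u -> b \in S -> b \notin component (S :\ s) u ->
  dist e a b = dist e a s + dist e s b.
Proof.
move=> cS Su Ca Sb nCb; have [n] := ubnP (dist e a b).
elim: n => // n IHn in a Ca *; rewrite ltnS => le_n.
have Sa := component_sub Su Ca; have := Sa; rewrite in_setD1 => /andP[nas Sa'].
have neq_ab : a != b by apply: contraNneq nCb => <-.
have [c [Sc ac dab]] := dist_step cS Sa' Sb neq_ab.
have [cs | neq_cs] := eqVneq c s.
  by move: (dist_edge ac) (dist_triangle a s b) dab; rewrite cs; clear; lia.
have Cc : c \in component (S :\ s) u.
  move: Ca; rewrite !inE => Ca; apply: connect_trans Ca (connect1 _).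
  by rewrite /within ac Sa in_setD1 neq_cs Sc.
move: (IHn c Cc) (dist_edge ac) (dist_triangle a c s) (dist_triangle a s b) dab le_n.
by clear; lia.
Qed.

(* Induction on the sum of the distances and on a connected set S containing the
   four vertices: any further vertex s of S is either superfluous or separates them.
   A split 1 + 3 shifts the three sums alike when the lone vertex moves to s,
   and after a split 2 + 2 the two largest sums agree. *)
Lemma dist_four_point u v w x :
  four_point (dist e u v + dist e w x) (dist e u w + dist e v x)
             (dist e u x + dist e v w).
Proof.
have [N] := ubnP (dist e u v + dist e w x + dist e u w + dist e v x
                  + dist e u x + dist e v w).
elim: N => // N IHN in u v w x *; rewrite ltnS => le_N.
suff IHS m (S : {set T}) : connected_set S -> #|S| < m ->
    [/\ u \in S, v \in S, w \in S & x \in S] ->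
    four_point (dist e u v + dist e w x) (dist e u w + dist e v x)
               (dist e u x + dist e v w).
  by apply: (IHS _ _ connected_setT (ltnSn _)); rewrite !inE.
elim: m S => // m IHm S cS; rewrite ltnS => le_m [Su Sv Sw Sx].
have pos a b : a != b -> 0 < dist e a b.
  by rewrite lt0n; apply: contraNneq => /dist_eq0 ->.
have sy := dist_sym; have tri := dist_triangle.
(* If [S] holds only the four vertices and they are distinct, [dist_step] provides the hypotheses of
   [four_point_four_vertices]. *)
have [s | noS] := pickP [pred s in S | s \notin [:: u; v; w; x]]; last first.
  have inS c : c \in S -> [\/ c = u, c = v, c = w | c = x].
    move=> Sc; have := noS c; rewrite /= Sc /= !inE => /negbFE.
    by case/or4P=> /eqP ->; [apply: Or41|apply: Or42|apply: Or43|apply: Or44].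
  have dxx := dist_refl.
  have [uv|nuv] := eqVneq u v.
    by rewrite uv dxx; move: (tri w v x); rewrite (sy w v); rewrite /four_point; clear; lia.
  have [uw|nuw] := eqVneq u w.
    by rewrite uw dxx; move: (tri v w x); rewrite (sy v w); rewrite /four_point; clear; lia.
  have [ux|nux] := eqVneq u x.
    rewrite ux dxx; move: (tri v x w); rewrite (sy x v) (sy w x).
    by rewrite /four_point; clear; lia.
  have [vw|nvw] := eqVneq v w.
    by rewrite vw dxx; move: (tri u w x); rewrite /four_point; clear; lia.
  have [vx|nvx] := eqVneq v x.
    by rewrite vx dxx; move: (tri u x w); rewrite (sy x w); rewrite /four_point; clear; lia.
  have [wx|nwx] := eqVneq w x.
    by rewrite wx dxx; move: (tri u x v); rewrite (sy x v); rewrite /four_point; clear; lia.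
  have st a b : a \in S -> b \in S -> a != b -> exists c,
     [/\ [\/ c = u, c = v, c = w | c = x], dist e a c <= 1, c != a & dist e a b = (dist e c b).+1].
    move=> Sa Sb nab; have [c [Sc ac dab]] := dist_step cS Sa Sb nab.
    exists c; split; rewrite ?dist_edge //; first exact: inS.
    by apply/eqP=> ca; move: dab; rewrite ca => /n_Sn.
  have sort_terminals := (sy v u, sy w u, sy x u, sy w v, sy x v, sy x w).
  have p1 := pos _ _ nuv; have p2 := pos _ _ nuw; have p3 := pos _ _ nux.
  have p4 := pos _ _ nvw; have p5 := pos _ _ nvx; have p6 := pos _ _ nwx.
  apply: four_point_four_vertices => //.
  - have [c [dc h1 h2 h3]] := st _ _ Su Sv nuv.
    move: p1 p2 p3 p4 p5 p6 h1 h2 h3.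
    by case: dc => ->; rewrite ?sort_terminals ?eqxx ?dxx; clear; lia.
  - have [c [dc h1 h2 h3]] := st _ _ Su Sw nuw.
    move: p1 p2 p3 p4 p5 p6 h1 h2 h3.
    by case: dc => ->; rewrite ?sort_terminals ?eqxx ?dxx; clear; lia.
  - have [c [dc h1 h2 h3]] := st _ _ Su Sx nux.
    move: p1 p2 p3 p4 p5 p6 h1 h2 h3.
    by case: dc => ->; rewrite ?sort_terminals ?eqxx ?dxx; clear; lia.
  - have [c [dc h1 h2 h3]] := st _ _ Sv Sw nvw.
    move: p1 p2 p3 p4 p5 p6 h1 h2 h3.
    by case: dc => ->; rewrite ?sort_terminals ?eqxx ?dxx; clear; lia.
  - have [c [dc h1 h2 h3]] := st _ _ Sv Sx nvx.
    move: p1 p2 p3 p4 p5 p6 h1 h2 h3.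
    by case: dc => ->; rewrite ?sort_terminals ?eqxx ?dxx; clear; lia.
  - have [c [dc h1 h2 h3]] := st _ _ Sw Sx nwx.
    move: p1 p2 p3 p4 p5 p6 h1 h2 h3.
    by case: dc => ->; rewrite ?sort_terminals ?eqxx ?dxx; clear; lia.
  - by have := tri u w v; rewrite (sy w v).
  - by have := tri u x v; rewrite (sy x v).
  - by have := tri u x w; rewrite (sy x w).
  - by have := tri v u w; rewrite (sy v u).
  - by have := tri v x w; rewrite (sy x w).
  - by have := tri v u x; rewrite (sy v u).
  - by have := tri w u x; rewrite (sy w u).
  - by have := tri w v x; rewrite (sy w v).
case/andP=> Ss; rewrite !inE !negb_or => /and4P[su sv sw sx].
have Du : u \in S :\ s by rewrite in_setD1 eq_sym su.
have Cu : u \in component (S :\ s) u by rewrite inE.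
have [psu psx] := (pos _ _ su, pos _ _ sx); have [psv psw] := (pos _ _ sv, pos _ _ sw).
have cut a b Ca Sb nCb := @dist_cut S s u a b cS Du Ca Sb nCb.
have tuv := tri u s v; have twx := tri w s x; have tuw := tri u s w.
have tvx := tri v s x; have tux := tri u s x; have tvw := tri v s w.
rewrite (sy v s) (sy w s) (sy u s) in tuv twx tuw tvx tux tvw *.
have [Cv|nCv] := boolP (v \in component (S :\ s) u);
have [Cw|nCw] := boolP (w \in component (S :\ s) u);
have [Cx|nCx] := boolP (x \in component (S :\ s) u).
- apply: (IHm _ (@connected_component (S :\ s) u)) => //.
  apply: leq_trans le_m; apply: proper_card; apply/properP; split.
    by apply/subsetP=> a Ca; have := component_sub Du Ca; rewrite in_setD1 => /andP[].
  by exists s => //; apply: (contra (@component_sub (S :\ s) u Du s)); rewrite in_setD1 eqxx.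
- have E1 := cut u x Cu Sx nCx; have E2 := cut v x Cv Sx nCx; have E3 := cut w x Cw Sx nCx.
  have IH := IHN u v w s; rewrite (sy v s) (sy w s) (sy u s) in E1 E2 E3 IH *.
  have {}IH : _ := IH ltac:(move: le_N psu psv psw psx E1 E2 E3; clear; lia).
  by move: IH E1 E2 E3; rewrite /four_point; clear; lia.
- have E1 := cut u w Cu Sw nCw; have E2 := cut v w Cv Sw nCw; have E3 := cut x w Cx Sw nCw.
  have IH := IHN u v s x; rewrite (sy v s) (sy x s) (sy x w) (sy u s) in E1 E2 E3 IH *.
  have {}IH : _ := IH ltac:(move: le_N psu psv psw psx E1 E2 E3; clear; lia).
  by move: IH E1 E2 E3; rewrite /four_point; clear; lia.
(* Split 2 + 2: both sums of cross distances equal the total of the distances to [s], which bounds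
   the third sum by the triangle inequality. *)
- have E1 := cut u w Cu Sw nCw; have E2 := cut v w Cv Sw nCw.
  have E3 := cut u x Cu Sx nCx; have E4 := cut v x Cv Sx nCx.
  rewrite (sy v s) (sy u s) in E1 E2 E3 E4 *.
  by move: tuv twx tuw tvx tux tvw E1 E2 E3 E4; rewrite /four_point; clear; lia.
- have E1 := cut u v Cu Sv nCv; have E2 := cut w v Cw Sv nCv; have E3 := cut x v Cx Sv nCv.
  have IH := IHN u s w x; rewrite (sy w s) (sy x s) (sy x v) (sy w v) (sy u s) in E1 E2 E3 IH *.
  have {}IH : _ := IH ltac:(move: le_N psu psv psw psx E1 E2 E3; clear; lia).
  by move: IH E1 E2 E3; rewrite /four_point; clear; lia.
- have E1 := cut u v Cu Sv nCv; have E2 := cut w v Cw Sv nCv.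
  have E3 := cut u x Cu Sx nCx; have E4 := cut w x Cw Sx nCx.
  rewrite (sy w s) (sy w v) (sy u s) in E1 E2 E3 E4 *.
  by move: tuv twx tuw tvx tux tvw E1 E2 E3 E4; rewrite /four_point; clear; lia.
- have E1 := cut u v Cu Sv nCv; have E2 := cut x v Cx Sv nCv.
  have E3 := cut u w Cu Sw nCw; have E4 := cut x w Cx Sw nCw.
  rewrite (sy x s) (sy x v) (sy x w) (sy u s) in E1 E2 E3 E4 *.
  by move: tuv twx tuw tvx tux tvw E1 E2 E3 E4; rewrite /four_point; clear; lia.
- have E1 := cut u v Cu Sv nCv; have E2 := cut u w Cu Sw nCw; have E3 := cut u x Cu Sx nCx.
  have IH := IHN s v w x; rewrite (sy u s) in E1 E2 E3 IH *.
  have {}IH : _ := IH ltac:(move: le_N psu psv psw psx E1 E2 E3; clear; lia).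
  by move: IH E1 E2 E3; rewrite /four_point; clear; lia.
Qed.
End Distance.

(** * Triples and geodesics in a four-point metric *)

Section Geodesic.
Variables (T : Type) (d : T -> T -> nat).
Hypothesis d_sym : forall u v, d u v = d v u.
Hypothesis d_tri : forall u v w, d u w <= d u v + d v w.
Hypothesis d_four_point : forall u v w z,
  four_point (d u v + d w z) (d u w + d v z) (d u z + d v w).

Variables (k L : nat) (Q : nat -> T).
Hypothesis geoQ : forall i j, i <= j <= L -> d (Q i) (Q j) = j - i.
Hypothesis covQ : forall w, exists2 j, j <= L & d w (Q j) <= k.

Local Notation a w := (d w (Q 0)).
Local Notation b w := (d w (Q L)).

Lemma ends_triangle w : [/\ L <= a w + b w, a w <= b w + L & b w <= a w + L].
Proof.
have := d_tri (Q 0) w (Q L); have := d_tri w (Q L) (Q 0); have := d_tri w (Q 0) (Q L).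
rewrite !(d_sym _ w) (d_sym (Q L)) geoQ ?leqnn // subn0.
by split.
Qed.

Lemma ends_four_point j w : j <= L ->
  [/\ four_point (L + d w (Q j)) (a w + (L - j)) (b w + j),
      a w <= d w (Q j) + j & b w <= d w (Q j) + (L - j)].
Proof.
move=> le_j; have := d_four_point (Q 0) (Q L) (Q j) w.
have := d_tri w (Q j) (Q 0); have := d_tri w (Q j) (Q L).
rewrite (d_sym (Q j) (Q 0)) (d_sym (Q L) (Q j)) !(d_sym _ w) !geoQ ?leqnn ?andbT // !subn0.
by rewrite /four_point => ? ? ?; split=> //; lia.
Qed.

(* Along Q, the distance from w falls and rises with slope 1 around the position
   (a w - b w + L) / 2, where it is determined up to 2. *)
Lemma dist_before j w : j <= L -> b w + 2 * j < a w + L -> d w (Q j) + j = a w.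
Proof.
by move=> le_j; have [] := ends_four_point w le_j; rewrite /four_point; lia.
Qed.

Lemma dist_after j w : j <= L -> a w + L < b w + 2 * j -> d w (Q j) + L = b w + j.
Proof.
by move=> le_j; have [] := ends_four_point w le_j; rewrite /four_point; lia.
Qed.

Lemma dist_at j w : j <= L -> a w + L = b w + 2 * j ->
  a w <= d w (Q j) + j /\ d w (Q j) + j <= a w + 2.
Proof.
by move=> le_j; have [] := ends_four_point w le_j; rewrite /four_point; lia.
Qed.

Lemma ends_sum_le w : a w + b w <= L + 2 * k.
Proof.
by have [j le_j] := covQ w; have [_] := ends_four_point w le_j; clear -le_j; lia.
Qed.

(** Equality in [ends_sum_le] forces a vertex of [Q] within [k] of [w] to sit at the position of
    [w], so it is [Q j]. *)
Lemma dist_at_max j w : j <= L -> a w + L = b w + 2 * j ->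
  a w + b w = L + 2 * k -> d w (Q j) = k.
Proof.
move=> le_j Ej Ek; have [i le_i leQi] := covQ w.
have [Eij | neq_ij] := eqVneq i j.
  by move: leQi (dist_at le_j Ej); rewrite Eij; move: Ek Ej le_j; clear; lia.
have [_] := ends_four_point w le_i.
by move: leQi Ek Ej le_j le_i neq_ij; clear; lia.
Qed.

(** The four-point condition for [u], [w] and the ends of [Q]. The hypothesis says that the position
    of [u] on [Q] precedes that of [w]; then [d u w] is the length of the route along [Q], as in a
    tree. The exception needs positions at most 1 apart. *)
Lemma pair_lt u w : a u + b w < a w + b u ->
  L + d u w = a w + b u \/ a w + b u <= a u + b w + 2 /\ L + d u w = a u + b w.
Proof.
have := d_four_point (Q 0) (Q L) u w; rewrite geoQ ?leqnn // subn0.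
rewrite (d_sym (Q 0) u) (d_sym (Q L) w) (d_sym (Q 0) w) (d_sym (Q L) u).
by rewrite /four_point; clear; lia.
Qed.

Lemma pair_eq u w : a u + b w = a w + b u -> L + d u w <= a u + b w + 2.
Proof.
have := d_four_point (Q 0) (Q L) u w; rewrite geoQ ?leqnn // subn0.
rewrite (d_sym (Q 0) u) (d_sym (Q L) w) (d_sym (Q 0) w) (d_sym (Q L) u).
by rewrite /four_point; clear; lia.
Qed.

(** All three legs are at least [k]; the inequalities are doubled and free of truncated
    subtraction. *)
Definition wide_triple (x y z : T) : Prop :=
  [/\ d y z + 2 * k <= d x y + d x z,
      d x z + 2 * k <= d x y + d y z &
      d x y + 2 * k <= d x z + d y z].

(** Two legs add up to a distance, so the triangle inequality turns the first three bounds into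
    equalities. The last clause says that some leg is exactly [k]. *)
Definition center (x y z q : T) : Prop :=
  [/\ d y z + 2 * d x q <= d x y + d x z,
      d x z + 2 * d y q <= d x y + d y z,
      d x y + 2 * d z q <= d x z + d y z &
      d y z + 2 * k = d x y + d x z \/ d x z + 2 * k = d x y + d y z
      \/ d x y + 2 * k = d x z + d y z].

(** With [y] strictly between [x] and [z] along [Q], wideness forces [a y + b y] to its maximum. The
    vertex at the position of [y] is then at distance [k] from [y], and its distances to [x] and [z]
    are determined exactly. *)
Lemma center_lt_lt x y z : wide_triple x y z ->
  a x + b y < a y + b x -> a y + b z < a z + b y ->
  exists2 j, j <= L & center x y z (Q j).
Proof.
move=> [Ax Ay Az] lt_xy lt_yz.
have [Tx1 Tx2 Tx3] := ends_triangle x; have Cx := ends_sum_le x.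
have [Ty1 Ty2 Ty3] := ends_triangle y; have Cy := ends_sum_le y.
have [Tz1 Tz2 Tz3] := ends_triangle z; have Cz := ends_sum_le z.
have Fxy := pair_lt lt_xy; have Fyz := pair_lt lt_yz.
have lt_xz : a x + b z < a z + b x by move: lt_xy lt_yz; clear; lia.
have Fxz := pair_lt lt_xz.
have Ek : a y + b y = L + 2 * k by lia.
have [n En] : exists n, a y + L = b y + 2 * n.
  by exists ((a y + L - b y) %/ 2); move: Ek Ty3; clear; lia.
have le_n : n <= L by move: En Ty2; clear; lia.
have Yn := dist_at_max le_n En Ek.
have Xn : d x (Q n) + L = b x + n.
  by apply: dist_after => //; move: En lt_xy; clear; lia.
have Zn : d z (Q n) + n = a z.
  by apply: dist_before => //; move: En lt_yz; clear; lia.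
by exists n => //; split; lia.
Qed.

(** The center is [Q n] or [Q n.+1], where [n] is the common position of [x] and [y], rounded down;
    [z] lies further on, so [n.+1] is still on [Q]. *)
Lemma center_eq_lt x y z : wide_triple x y z ->
  a x + b y = a y + b x -> a y + b z < a z + b y ->
  exists2 j, j <= L & center x y z (Q j).
Proof.
move=> [Ax Ay Az] eq_xy lt_yz.
have [Tx1 Tx2 Tx3] := ends_triangle x; have Cx := ends_sum_le x.
have [Ty1 Ty2 Ty3] := ends_triangle y; have Cy := ends_sum_le y.
have [Tz1 Tz2 Tz3] := ends_triangle z; have Cz := ends_sum_le z.
have Dxy : 2 * k <= d x y by move: Ax Ay; clear; lia.
have Dyz : 2 * k <= d y z by move: Az Ay; clear; lia.
have Dxz : 2 * k <= d x z by move: Az Ax; clear; lia.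
pose n := (a y + L - b y) %/ 2.
have En : a y + L = b y + 2 * n \/ a y + L = b y + 2 * n + 1.
  by rewrite /n; move: Ty3; clear; lia.
have lt_n : n.+1 <= L by move: En lt_yz Tz2; clear; lia.
have le_n := ltnW lt_n.
move: n En lt_n le_n => n En lt_n le_n.
have Zn : d z (Q n) + n = a z by apply: dist_before => //; move: En lt_yz; clear; lia.
have lt_xz : a x + b z < a z + b x by move: eq_xy lt_yz; clear; lia.
have X1 : d x (Q n.+1) + L = b x + n.+1.
  by apply: dist_after => //; move: En eq_xy; clear; lia.
have Y1 : d y (Q n.+1) + L = b y + n.+1.
  by apply: dist_after => //; move: En eq_xy; clear; lia.
have Fxy := pair_eq eq_xy; have Fxz := pair_lt lt_xz; have Fyz := pair_lt lt_yz.
have Rn : d x y <= d x (Q n) + d y (Q n) by rewrite (d_sym y) d_tri.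
have RZ : d x z <= d x (Q n.+1) + d z (Q n.+1) by rewrite (d_sym z) d_tri.
case: En => En.
  have eq_x : a x + L = b x + 2 * n by move: En eq_xy; clear; lia.
  (* The gap [gx] is half of [a x + b x - L], the distance from [x] to [Q] if the graph were a
     tree. *)
  have [gx [Gx1 Gx2]] : exists g, a x = n + g /\ b x + n = L + g.
    by exists (a x - n); move: Tx1 Tx2 Tx3 le_n eq_x; clear; lia.
  have [gy [Gy1 Gy2]] : exists g, a y = n + g /\ b y + n = L + g.
    by exists (a y - n); move: Ty1 Ty2 Ty3 le_n En; clear; lia.
  have [Xn1 Xn2] := dist_at le_n eq_x; have [Yn1 Yn2] := dist_at le_n En.
  have Xk := dist_at_max le_n eq_x; have Yk := dist_at_max le_n En.
  rewrite Gx1 Gy1 in Xn1 Xn2 Yn1 Yn2 Xk Yk.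
  have le_gx : gx <= k by move: Gx1 Gx2 Cx; clear; lia.
  have le_gy : gy <= k by move: Gy1 Gy2 Cy; clear; lia.
  have {}Xk : gx = k -> d x (Q n) = k by move: Gx2 Xk; clear; lia.
  have {}Yk : gy = k -> d y (Q n) = k by move: Gy2 Yk; clear; lia.
  have {}X1 : d x (Q n.+1) = gx.+1 by move: X1 Gx2; clear; lia.
  have {}Y1 : d y (Q n.+1) = gy.+1 by move: Y1 Gy2; clear; lia.
  have {}Fxy : d x y <= gx + gy + 2 by move: Fxy Gx1 Gy2; clear; lia.
  have {}Fxz : d x z = d z (Q n) + gx \/
      a z + b x <= a x + b z + 2 /\ L + d x z = a x + b z.
    by move: Fxz Gx2 Zn; clear; lia.
  have {}Fyz : d y z = d z (Q n) + gy \/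
      a z + b y <= a y + b z + 2 /\ L + d y z = a y + b z.
    by move: Fyz Gy2 Zn; clear; lia.
  have [Pz | [Pz | Pz]] : a z + L = b z + 2 * n + 1 \/ a z + L = b z + 2 * n.+1
      \/ b z + 2 * n.+1 < a z + L.
  - by move: lt_yz En; clear; lia.
  - have Zk : d z (Q n) <= k by move: Pz Zn Cz; clear; lia.
    exists n => //; split;
      move: Fxz Fyz Xk Yk Xn1 Yn1 Zn Zk Dxy Dyz Dxz le_gx le_gy Gx1 Gy1 Pz Rn;
      by clear; lia.
  - have [Z1 Z2] := dist_at lt_n Pz; have Zk := dist_at_max lt_n Pz.
    have le_Z : d z (Q n) <= k.+1 by move: Pz Zn Cz; clear; lia.
    have {}Zk : d z (Q n) = k.+1 -> d z (Q n.+1) = k by move: Zk Pz Zn; clear; lia.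
    have {}Fxz : d x z = d z (Q n) + gx by move: Fxz Dxz le_Z le_gx Zn Pz Gx1; clear; lia.
    have {}Fyz : d y z = d z (Q n) + gy by move: Fyz Dyz le_Z le_gy Zn Pz Gy1; clear; lia.
    (* [Q n] is the center if both gaps are [k]; a gap [k - 1] moves the center to [Q n.+1]. *)
    have [gxk | gxk] : gx = k \/ gx.+1 = k by move: Fxz Dxz le_gx le_Z; clear; lia.
      have [gyk | gyk] : gy = k \/ gy.+1 = k by move: Fyz Dyz le_gy le_Z; clear; lia.
        by exists n => //; split; lia.
      by exists n.+1 => //; split; lia.
    by exists n.+1 => //; split; lia.
  have Z1 : d z (Q n.+1) + n.+1 = a z by apply: dist_before.
  have {}Fxz : d x z = d z (Q n) + gx by move: Fxz Pz Gx1 Gx2 Zn; clear; lia.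
  have {}Fyz : d y z = d z (Q n) + gy by move: Fyz Pz Gy1 Gy2 Zn; clear; lia.
  have [gxk | gxk] : gx = k \/ gx.+1 = k by lia.
    have [gyk | gyk] : gy = k \/ gy.+1 = k by lia.
      by exists n => //; split; lia.
    by exists n.+1 => //; split; lia.
  by exists n.+1 => //; split; lia.
(* Now the common position is the middle of the edge from [Q n] to [Q n.+1], so the distances to
   both ends are exact; the end on the side of [z] is the center. *)
have Xn : d x (Q n) + n = a x by apply: dist_before => //; move: En eq_xy; clear; lia.
have Yn : d y (Q n) + n = a y by apply: dist_before => //; move: En; clear; lia.
have {Rn Fxy} [xk yk dk] : [/\ d x (Q n) = k, d y (Q n) = k & d x y = 2 * k].
  by split; lia.
have xk1 : d x (Q n.+1) = k by lia.
have yk1 : d y (Q n.+1) = k by lia.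
have Z1 : d x z = d z (Q n.+1) + k /\ d y z = d z (Q n.+1) + k.
  have [Pz | Pz] : a z + L = b z + 2 * n.+1 \/ b z + 2 * n.+1 < a z + L.
  - by move: lt_yz En; clear; lia.
  - have [Z1 Z2] := dist_at lt_n Pz; have Zk := dist_at_max lt_n Pz.
    by lia.
  have Z1 : d z (Q n.+1) + n.+1 = a z by apply: dist_before.
  by lia.
by exists n.+1 => //; split; lia.
Qed.

(** The order along [Q] separates no two vertices here, so the four-point condition is also applied
    to each pair together with the edge from [Q n] to [Q n.+1]. *)
Lemma center_eq_eq x y z : wide_triple x y z ->
  a x + b y = a y + b x -> a y + b z = a z + b y ->
  exists2 j, j <= L & center x y z (Q j).
Proof.
move=> [Ax Ay Az] eq_xy eq_yz.
have eq_xz : a x + b z = a z + b x by move: eq_xy eq_yz; clear; lia.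
have [Tx1 Tx2 Tx3] := ends_triangle x; have Cx := ends_sum_le x.
have [Ty1 Ty2 Ty3] := ends_triangle y; have Cy := ends_sum_le y.
have [Tz1 Tz2 Tz3] := ends_triangle z; have Cz := ends_sum_le z.
have Dxy : 2 * k <= d x y by move: Ax Ay; clear; lia.
have Dyz : 2 * k <= d y z by move: Az Ay; clear; lia.
have Dxz : 2 * k <= d x z by move: Az Ax; clear; lia.
pose n := (a y + L - b y) %/ 2.
have En : a y + L = b y + 2 * n \/ a y + L = b y + 2 * n + 1.
  by rewrite /n; move: Ty3; clear; lia.
have le_n : n <= L by move: En Ty2; clear; lia.
move: n En le_n => n En le_n.
have Rxy : d x y <= d x (Q n) + d y (Q n) by rewrite (d_sym y) d_tri.
have Ryz : d y z <= d y (Q n) + d z (Q n) by rewrite (d_sym z) d_tri.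
have Rxz : d x z <= d x (Q n) + d z (Q n) by rewrite (d_sym z) d_tri.
case: En => En; last first.
  have Xn : d x (Q n) + n = a x by apply: dist_before => //; move: En eq_xy; clear; lia.
  have Yn : d y (Q n) + n = a y by apply: dist_before => //; move: En; clear; lia.
  have Zn : d z (Q n) + n = a z by apply: dist_before => //; move: En eq_yz; clear; lia.
  by exists n => //; split; lia.
have [lt_n | le_Ln] := ltnP n L; last first.
  have EL : n = L by move: le_n le_Ln; clear; lia.
  by exists n => //; rewrite EL in Rxy Ryz Rxz En *; split; lia.
have eq_x : a x + L = b x + 2 * n by move: En eq_xy; clear; lia.
have eq_z : a z + L = b z + 2 * n by move: En eq_yz; clear; lia.
have [gx [Gx1 Gx2]] : exists g, a x = n + g /\ b x + n = L + g.
  by exists (a x - n); move: Tx1 Tx2 Tx3 le_n eq_x; clear; lia.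
have [gy [Gy1 Gy2]] : exists g, a y = n + g /\ b y + n = L + g.
  by exists (a y - n); move: Ty1 Ty2 Ty3 le_n En; clear; lia.
have [gz [Gz1 Gz2]] : exists g, a z = n + g /\ b z + n = L + g.
  by exists (a z - n); move: Tz1 Tz2 Tz3 le_n eq_z; clear; lia.
have [Xn1 Xn2] := dist_at le_n eq_x; have [Yn1 Yn2] := dist_at le_n En.
have [Zn1 Zn2] := dist_at le_n eq_z.
have Xk := dist_at_max le_n eq_x; have Yk := dist_at_max le_n En.
have Zk := dist_at_max le_n eq_z.
have X1 : d x (Q n.+1) = gx.+1.
  have : d x (Q n.+1) + L = b x + n.+1 by apply: dist_after => //; rewrite eq_x mulnS; clear; lia.
  by move: Gx2; clear; lia.
have Y1 : d y (Q n.+1) = gy.+1.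
  have : d y (Q n.+1) + L = b y + n.+1 by apply: dist_after => //; rewrite En mulnS; clear; lia.
  by move: Gy2; clear; lia.
have Z1 : d z (Q n.+1) = gz.+1.
  have : d z (Q n.+1) + L = b z + n.+1 by apply: dist_after => //; rewrite eq_z mulnS; clear; lia.
  by move: Gz2; clear; lia.
have Fxy : d x y <= gx + gy + 2 by move: (pair_eq eq_xy) Gx1 Gy2; clear; lia.
have Fyz : d y z <= gy + gz + 2 by move: (pair_eq eq_yz) Gy1 Gz2; clear; lia.
have Fxz : d x z <= gx + gz + 2 by move: (pair_eq eq_xz) Gx1 Gz2; clear; lia.
have {Xk Xn1 Xn2 Gx1 Gx2 Cx eq_x Tx1 Tx2 Tx3} Xk :
    gx < k /\ gx <= d x (Q n) /\ d x (Q n) <= gx + 2 \/ gx = k /\ d x (Q n) = k.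
  by move: Xk Xn1 Xn2 Gx1 Gx2 Cx; clear; lia.
have {Yk Yn1 Yn2 Gy1 Gy2 Cy En Ty1 Ty2 Ty3} Yk :
    gy < k /\ gy <= d y (Q n) /\ d y (Q n) <= gy + 2 \/ gy = k /\ d y (Q n) = k.
  by move: Yk Yn1 Yn2 Gy1 Gy2 Cy; clear; lia.
have {Zk Zn1 Zn2 Gz1 Gz2 Cz eq_z Tz1 Tz2 Tz3} Zk :
    gz < k /\ gz <= d z (Q n) /\ d z (Q n) <= gz + 2 \/ gz = k /\ d z (Q n) = k.
  by move: Zk Zn1 Zn2 Gz1 Gz2 Cz; clear; lia.
have Q1 : d (Q n) (Q n.+1) = 1 by rewrite geoQ ?leqnSn // subSnn.
have := d_four_point x y (Q n) (Q n.+1).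
have := d_four_point y z (Q n) (Q n.+1).
have := d_four_point x z (Q n) (Q n.+1).
rewrite {}Q1 X1 Y1 Z1 /four_point => Dxz' Dyz' Dxy'.
clear eq_xy eq_yz eq_xz.
(* At least two gaps equal to [k] make [Q n] the center, none makes it [Q n.+1]. With exactly one,
   the distance from its vertex to another one decides. *)
case: Xk => [[Xk1 Xk2] | [Xk1 Xk2]]; case: Yk => [[Yk1 Yk2] | [Yk1 Yk2]];
case: Zk => [[Zk1 Zk2] | [Zk1 Zk2]].
- by exists n.+1 => //; split; rewrite ?X1 ?Y1 ?Z1; clear X1 Y1 Z1 Dxy' Dxz' Dyz'; lia.
- have [Ez | Ez] : d x z = 2 * k \/ d x z = (2 * k).+1 by lia.
    by exists n => //; clear X1 Y1 Z1; split; lia.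
  by exists n.+1 => //; split; rewrite ?X1 ?Y1 ?Z1; clear X1 Y1 Z1 Dxy' Dxz' Dyz'; lia.
- have [Ez | Ez] : d x y = 2 * k \/ d x y = (2 * k).+1 by lia.
    by exists n => //; clear X1 Y1 Z1; split; lia.
  by exists n.+1 => //; split; rewrite ?X1 ?Y1 ?Z1; clear X1 Y1 Z1 Dxy' Dxz' Dyz'; lia.
- by exists n => //; clear X1 Y1 Z1; split; lia.
- have [Ez | Ez] : d x y = 2 * k \/ d x y = (2 * k).+1 by lia.
    by exists n => //; clear X1 Y1 Z1; split; lia.
  by exists n.+1 => //; split; rewrite ?X1 ?Y1 ?Z1; clear X1 Y1 Z1 Dxy' Dxz' Dyz'; lia.
- by exists n => //; clear X1 Y1 Z1; split; lia.
- by exists n => //; clear X1 Y1 Z1; split; lia.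
- by exists n => //; clear X1 Y1 Z1; split; lia.
Qed.
End Geodesic.

(** * Centers of wide triples on a covering geodesic *)

Section FourPointMetric.
Variables (T : Type) (d : T -> T -> nat).
Hypothesis d_sym : forall u v, d u v = d v u.
Hypothesis d_tri : forall u v w, d u w <= d u v + d v w.
Hypothesis d_four_point : forall u v w z,
  four_point (d u v + d w z) (d u w + d v z) (d u z + d v w).

Lemma wide_triple_rev k x y z : wide_triple d k x y z -> wide_triple d k z y x.
Proof.
by case=> Ax Ay Az; rewrite /wide_triple !(d_sym z) (d_sym y x); split; lia.
Qed.

Lemma wide_triple_rot k x y z : wide_triple d k x y z -> wide_triple d k y z x.
Proof.
by case=> Ax Ay Az; rewrite /wide_triple (d_sym y x) (d_sym z x); split; lia.
Qed.

Lemma center_rev k x y z q : center d k x y z q -> center d k z y x q.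
Proof.
case=> Ax Ay Az Ak; rewrite /center (d_sym z y) (d_sym z x) (d_sym y x).
by split; lia.
Qed.

Lemma center_rot k x y z q : center d k y z x q -> center d k x y z q.
Proof.
by rewrite /center (d_sym y x) (d_sym z x) => -[Ax Ay Az Ak]; split; lia.
Qed.

Variables (k L : nat) (Q : nat -> T).
Hypothesis geoQ : forall i j, i <= j <= L -> d (Q i) (Q j) = j - i.
Hypothesis covQ : forall w, exists2 j, j <= L & d w (Q j) <= k.

Lemma wide_triple_center_sorted x y z : wide_triple d k x y z ->
  d x (Q 0) + d y (Q L) <= d y (Q 0) + d x (Q L) ->
  d y (Q 0) + d z (Q L) <= d z (Q 0) + d y (Q L) ->
  exists2 j, j <= L & center d k x y z (Q j).
Proof.
move=> W; rewrite !(leq_eqVlt (_ + _)) => /predU1P[xy | xy] /predU1P[yz | yz].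
- exact: center_eq_eq.
- exact: center_eq_lt.
(* Reversing [Q] and exchanging [x] with [z] reduces this case to [center_eq_lt]. *)
- pose Q' j := Q (L - j).
  have geoQ' i j : i <= j <= L -> d (Q' i) (Q' j) = j - i.
    by move=> le_ij; rewrite d_sym geoQ; move: le_ij; clear; lia.
  have covQ' w : exists2 j, j <= L & d w (Q' j) <= k.
    by have [j le_j wj] := covQ w; exists (L - j); rewrite ?leq_subr // /Q' subKn.
  have [j le_j cj] : exists2 j, j <= L & center d k z y x (Q' j).
    apply: center_eq_lt => //; first exact: wide_triple_rev.
      by rewrite /Q' subn0 subnn; move: yz; clear; lia.
    by rewrite /Q' subn0 subnn; move: xy; clear; lia.
  by exists (L - j); rewrite ?leq_subr //; apply: center_rev.
- exact: center_lt_lt.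
Qed.

(* In a tree this says that a tripod with legs of length at least k has its center
   on Q, and that one of its legs has length k. *)
Lemma wide_triple_center x y z : wide_triple d k x y z ->
  exists2 j, j <= L & center d k x y z (Q j).
Proof.
have srt u v : d u (Q 0) + d v (Q L) <= d v (Q 0) + d u (Q L)
    \/ d v (Q 0) + d u (Q L) <= d u (Q 0) + d v (Q L).
  by clear; lia.
move=> W; have W2 := wide_triple_rot W; have W3 := wide_triple_rot W2.
have [xy|yx] := srt x y; have [yz|zy] := srt y z; have [xz|zx] := srt x z.
- exact: wide_triple_center_sorted.
- exact: wide_triple_center_sorted.
- have [j le_j cj] := wide_triple_center_sorted (wide_triple_rev W2) xz zy.
  by exists j => //; apply/center_rot/center_rev.
- have [j le_j cj] := wide_triple_center_sorted W3 zx xy.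
  by exists j => //; do 2!apply: center_rot.
- have [j le_j cj] := wide_triple_center_sorted (wide_triple_rev W3) yx xz.
  by exists j => //; apply/center_rot/center_rot/center_rev.
- have [j le_j cj] := wide_triple_center_sorted W2 yz zx.
  by exists j => //; apply: center_rot.
- have [j le_j cj] := wide_triple_center_sorted (wide_triple_rev W) zy yx.
  by exists j => //; apply: center_rev.
- have [j le_j cj] := wide_triple_center_sorted (wide_triple_rev W) zy yx.
  by exists j => //; apply: center_rev.
Qed.

Lemma wide_triple_min x y z : wide_triple d k x y z ->
  [\/ d y z + 2 * k = d x y + d x z, d x z + 2 * k = d x y + d y z
    | d x y + 2 * k = d x z + d y z].
Proof.
move=> W; have [j _ [_ _ _]] := wide_triple_center W.
by case=> [|[]]; [apply: Or31 | apply: Or32 | apply: Or33].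
Qed.

Lemma dist_on_geodesic i j : i <= L -> j <= L -> d (Q i) (Q j) = (i - j) + (j - i).
Proof.
move=> le_i le_j; have [le_ij | lt_ji] := leqP i j.
  by rewrite geoQ ?le_ij //; move: le_ij; clear; lia.
by rewrite d_sym geoQ ?(ltnW lt_ji) //; move: lt_ji; clear; lia.
Qed.

(** A vertex [Q m] outside the segment from [Q i] to [Q j] violates the four-point condition with
    [v] or [w], and each end of the segment is too far from one of them. *)
Lemma midpoint_on_geodesic v w i j m : i <= L -> j <= L -> m <= L ->
  d v (Q i) = k -> d w (Q j) = k -> d v (Q j) = k.+2 -> d w (Q i) = k.+2 ->
  d (Q i) (Q j) = 2 -> d v (Q m) <= k.+1 -> d w (Q m) <= k.+1 -> 2 * m = i + j.
Proof.
move=> le_i le_j le_m vi wj vj wi ij vm wm.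
have := d_four_point v (Q i) (Q j) (Q m); have := d_four_point w (Q i) (Q j) (Q m).
move: ij; rewrite !dist_on_geodesic // vi vj wi wj /four_point.
by move: vm wm; clear; lia.
Qed.

(* Otherwise d(v,w) is 2k+1 or 2k+2, so that x, v, w or y, v, w has no leg equal
   to k, or both triples have the midpoint of Q i and Q j as their center on Q,
   which brings x and y too close to each other. *)
Lemma center_chain x y v w i j : i <= L -> j <= L -> (forall u u', d u u' <= d x y) ->
  d x y = d x (Q i) + d y (Q i) -> d x (Q j) = d x (Q i) -> d y (Q j) = d y (Q i) ->
  d x v = d x (Q i) + k -> d y v = d y (Q i) + k ->
  d x w = d x (Q i) + k -> d y w = d y (Q i) + k ->
  d v (Q i) = k -> d w (Q j) = k -> d w (Q i) = k \/ d v (Q j) = k.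
Proof.
move=> le_i le_j diam_xy Dxy xj yj xv yv xw yw vi wj.
have [|nwi] := eqVneq (d w (Q i)) k; first by left.
have [|nvj] := eqVneq (d v (Q j)) k; first by right.
exfalso.
have ij2 : d (Q i) (Q j) <= 2.
  have := d_four_point x y (Q i) (Q j).
  by move: Dxy xj yj; rewrite /four_point; clear; lia.
have wi_gt : k < d w (Q i).
  by move: (d_tri x (Q i) w) nwi; rewrite (d_sym (Q i)) xw; clear; lia.
have vj_gt : k < d v (Q j).
  by move: (d_tri x (Q j) v) nvj; rewrite (d_sym (Q j)) xv xj; clear; lia.
have wi_le : d w (Q i) <= k + d (Q i) (Q j) by rewrite addnC -wj d_sym (d_sym w) d_tri.
have vj_le : d v (Q j) <= k + d (Q i) (Q j) by rewrite -vi d_tri.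
have Fi := d_four_point x v w (Q i); have Fj := d_four_point x v w (Q j).
have Fij := d_four_point v w (Q i) (Q j); have Fv := d_four_point x v (Q i) (Q j).
rewrite xj xv ?xw vi ?wj /four_point in Fi Fj Fij Fv.
have [vw | [vw wi vj ij]] : d v w = (2 * k).+1 \/
    [/\ d v w = (2 * k).+2, d w (Q i) = k.+2, d v (Q j) = k.+2 & d (Q i) (Q j) = 2].
  have [vw | [vw | vw]] : d v w = (2 * k).+1 \/ d v w = (2 * k).+2
      \/ d v w <= 2 * k.
  - by move: Fi Fj wi_gt vj_gt wi_le vj_le ij2; clear; lia.
  - by left.
  - right; split=> //.
    + by move: vw Fi wi_gt wi_le ij2; clear; lia.
    + by move: vw Fj vj_gt vj_le ij2; clear; lia.
    + by move: vw ij2 Fij Fi Fj wi_gt wi_le vj_gt vj_le; clear; lia.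
  by move: vw ij2 Fij Fi Fj Fv wi_gt wi_le vj_gt vj_le; clear; lia.
(* The doubled legs of [x], [v], [w] are [2 * d x (Q i) - 1], [2 * k + 1] and [2 * k + 1]: all odd,
   so none is [2 * k]. If [x] is too close for a wide triple, then [y] is not, since
   [d v w <= d x y]. *)
- have [ltx | ltx] := ltnP k (d x (Q i)).
    have W : wide_triple d k x v w.
      by split; rewrite xv xw vw; move: ltx; clear; lia.
    by case: (wide_triple_min W); rewrite xv xw vw; move: ltx; clear; lia.
  have lty : k < d y (Q i) by move: (diam_xy v w) ltx; rewrite vw Dxy; clear; lia.
  have W : wide_triple d k y v w.
    by split; rewrite yv yw vw; move: lty; clear; lia.
  by case: (wide_triple_min W); rewrite yv yw vw; move: lty; clear; lia.
have Wx : k < d x (Q i) -> wide_triple d k x v w.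
  by move=> ltx; split; rewrite xv xw vw; move: ltx; clear; lia.
have Wy : k < d y (Q i) -> wide_triple d k y v w.
  by move=> lty; split; rewrite yv yw vw; move: lty; clear; lia.
(* Now the legs are [d x (Q i) - 1], [k + 1] and [k + 1], so a larger distance would leave no leg
   equal to [k]. With the same bound for [y], [d v w <= d x y] gives equality in both. *)
have le_x : d x (Q i) <= k.+1.
  rewrite leqNgt; apply/negP => ltx; case: (wide_triple_min (Wx (ltnW ltx)));
  by rewrite xv xw vw; move: ltx; clear; lia.
have le_y : d y (Q i) <= k.+1.
  rewrite leqNgt; apply/negP => lty; case: (wide_triple_min (Wy (ltnW lty)));
  by rewrite yv yw vw; move: lty; clear; lia.
have := diam_xy v w; rewrite vw Dxy => leD.
have xi : d x (Q i) = k.+1 by move: le_x le_y leD; clear; lia.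
have yi : d y (Q i) = k.+1 by move: le_x le_y leD; clear; lia.
have ltx : k < d x (Q i) by rewrite xi.
have lty : k < d y (Q i) by rewrite yi.
(* Both centers are the midpoint of [Q i] and [Q j], within [k] of [x] and of [y], although [d x y]
   is [2 * k + 2]. *)
have [m le_m [mx mv mw _]] := wide_triple_center (Wx ltx).
have [n le_n [ny nv nw _]] := wide_triple_center (Wy lty).
rewrite xv xw vw xi in mx mv mw; rewrite yv yw vw yi in ny nv nw.
have mid l : l <= L -> d v (Q l) <= k.+1 -> d w (Q l) <= k.+1 -> 2 * l = i + j.
  by move=> le_l; apply: midpoint_on_geodesic.
have Em : 2 * m = i + j by apply: mid => //; [move: mv | move: mw]; clear; lia.
have En : 2 * n = i + j by apply: mid => //; [move: nv | move: nw]; clear; lia.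
have Emn : n = m by move: Em En; clear; lia.
move: (d_tri x (Q m) y) mx ny; rewrite Emn (d_sym (Q m)) Dxy xi yi.
by clear; lia.
Qed.
End FourPointMetric.

(** * Paths through slice centers *)

Section SliceCenters.
Variables (T : finType) (d : T -> T -> nat).
Hypothesis d_refl : forall u, d u u = 0.
Hypothesis d_eq0 : forall u v, d u v = 0 -> u = v.
Hypothesis d_sym : forall u v, d u v = d v u.
Hypothesis d_tri : forall u v w, d u w <= d u v + d v w.
Hypothesis d_four_point : forall u v w z,
  four_point (d u v + d w z) (d u w + d v z) (d u z + d v w).
Variables (k L : nat) (Q : nat -> T).
Hypothesis geoQ : forall i j, i <= j <= L -> d (Q i) (Q j) = j - i.
Hypothesis covQ : forall w, exists2 j, j <= L & d w (Q j) <= k.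
Variables (x y : T).
Hypothesis diam_xy : forall u v, d u v <= d x y.

(** No distance exceeds [d x y], so [v] has the smallest leg. Were it above [k], no leg would equal
    [k], against [wide_triple_min]. *)
Lemma gromov_le v : d x v + d y v <= d x y + 2 * k.
Proof.
rewrite leqNgt; apply/negP => lt_k.
have W : wide_triple d k x y v.
  by split; move: lt_k (diam_xy x v) (diam_xy y v); clear; lia.
case: (wide_triple_min d_sym d_tri d_four_point geoQ covQ W);
  by move: lt_k (diam_xy x v) (diam_xy y v); clear; lia.
Qed.

(** Among the vertices of leg [k] with centers in slice [i], one with the fewest centers on [Q] is
    taken; any of its centers serves all the others. Without such vertices, [c0] will do. *)
Lemma slice_center i c0 : d x c0 = i -> d x c0 + d y c0 = d x y ->
  exists c, [/\ d x c = i, d x c + d y c = d x y &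
    forall v, d x v = i + k -> d x v + d y v = d x y + 2 * k -> d v c = k].
Proof.
move=> xc0 yc0; pose far v := (d x v == i + k) && (d x v + d y v == d x y + 2 * k).
have [v0 far0 | nofar] := pickP far; last first.
  exists c0; split=> // v xv yv.
  by have := nofar v; rewrite /far yv xv !eqxx.
pose M v := [set j : 'I_L.+1 |
  [&& d x (Q j) == i, d x (Q j) + d y (Q j) == d x y & d v (Q j) == k]].
have M_neq0 v : far v -> exists j, j \in M v.
  case/andP=> /eqP xv /eqP yv.
  have W : wide_triple d k x y v.
    by split; move: xv yv (diam_xy x v) (diam_xy y v); clear; lia.
  have [j le_j [Cx Cy Cv _]] := wide_triple_center d_sym d_tri d_four_point geoQ covQ W.
  exists (Ordinal (le_j : j < L.+1)); rewrite inE /=.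
  have := d_tri x (Q j) y; have := d_tri x (Q j) v.
  rewrite (d_sym (Q j) y) (d_sym (Q j) v); move: Cx Cy Cv xv yv; clear; lia.
have [v farv minv] := arg_minnP (fun v => #|M v|) far0.
have [j Mj] := M_neq0 v farv.
move: (Mj); rewrite inE => /and3P[/eqP xj /eqP yj /eqP vj].
exists (Q j); split=> // w xw yw.
have farw : far w by rewrite /far yw xw !eqxx.
have [// | nwj] := eqVneq (d w (Q j)) k.
suff lt_M : #|M w| < #|M v| by have := minv w farw; rewrite leqNgt lt_M.
apply: proper_card; apply/properP; split; last first.
  by exists j => //; rewrite inE (negPf nwj) !andbF.
(* Since [Q j] fails for [w], [center_chain] makes every center for [w] one for [v]. *)
apply/subsetP=> j'; rewrite !inE => /and3P[/eqP xj' /eqP yj' /eqP wj'].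
apply/and3P; split; apply/eqP; [exact: xj' | exact: yj' |].
case/andP: farv => /eqP xv /eqP yv.
have := center_chain d_sym d_tri d_four_point geoQ covQ (leq_ord j) (leq_ord j') diam_xy.
move=> /(_ v w); rewrite xj xj' => chain.
have yjj' : d y (Q j') = d y (Q j) by move: yj xj yj' xj'; clear; lia.
have yv' : d y v = d y (Q j) + k by move: yj xj xv yv; clear; lia.
have yw' : d y w = d y (Q j) + k by move: yj xj xw yw; clear; lia.
have Dxy : d x y = i + d y (Q j) by rewrite -yj xj.
case: (chain Dxy erefl yjj' xv yv' xw yw' vj wj') => // wj.
by rewrite wj eqxx in nwj.
Qed.

Variable c : nat -> T.
Hypothesis c_slice : forall i, i <= d x y -> d x (c i) = i /\ d x (c i) + d y (c i) = d x y.
Hypothesis c_center : forall i v, i <= d x y ->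
  d x v = i + k -> d x v + d y v = d x y + 2 * k -> d v (c i) = k.

(** For [i < j], two of the three sums for [x], [y], [c i], [c j] differ by [2 * (j - i)]; the third
    equals the larger one, as equality with the smaller would make [d (c i) (c j)] negative. *)
Lemma slices_geodesic i j : i <= j <= d x y -> d (c i) (c j) = j - i.
Proof.
case/andP; rewrite leq_eqVlt => /predU1P[-> | lt_ij le_j]; first by rewrite d_refl subnn.
have [xi yi] := c_slice (leq_trans (ltnW lt_ij) le_j).
have [xj yj] := c_slice le_j; have := d_four_point x y (c i) (c j).
by rewrite /four_point; move: xi yi xj yj lt_ij; clear; lia.
Qed.

Lemma slices_ends : c 0 = x /\ c (d x y) = y.
Proof.
have [x0 _] := c_slice (leq0n _); have [xD yD] := c_slice (leqnn _).
by split; apply: d_eq0; rewrite d_sym //; move: xD yD; clear; lia.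
Qed.

Lemma slices_cover v : exists2 i, i <= d x y & d v (c i) <= k.
Proof.
have [c0 cD] := slices_ends; have geo := slices_geodesic; have le_k := gromov_le v.
have [T1 T2 T3] := ends_triangle d_sym d_tri geo v.
have before := @dist_before T d d_sym d_tri d_four_point _ c geo.
rewrite c0 cD (d_sym v x) (d_sym v y) in T1 T2 T3 before.
pose i := (d x v + d x y - d y v) %/ 2.
have Ei : d x v + d x y = d y v + 2 * i \/ d x v + d x y = d y v + 2 * i + 1.
  by rewrite /i; move: T3; clear; lia.
have le_i : i <= d x y by move: Ei T2; clear; lia.
(* In the odd case the leg of [v] is a half-integer below [k], and [c i] is only half a step farther
   from [v] than this leg. *)
move: i Ei le_i => i [Ei | Ei] le_i; last first.
  exists i => //; have := before i v le_i; rewrite (d_sym v x) (d_sym v y).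
  by move: Ei le_k; clear; lia.
have [Ek | nEk] := eqVneq (d x v + d y v) (d x y + 2 * k).
  by exists i => //; rewrite c_center //; move: Ek Ei; clear; lia.
(* At the position of [v] the distance is known only up to 2. One vertex earlier it is exactly the
   leg plus 1, at most [k] since the leg is smaller than [k]; at position 0 the vertex is [x]
   itself. *)
case: i => [|i] in Ei le_i *.
  by exists 0 => //; rewrite c0 d_sym; move: Ei le_k; clear; lia.
exists i; first exact: ltnW.
have := before i v (ltnW le_i); rewrite (d_sym v x) (d_sym v y).
by move: Ei le_k nEk; clear; lia.
Qed.
End SliceCenters.

(** * Eccentricity of paths *)

Section Eccentricity.
Variables (T : finType) (e : rel T).
Hypothesis e_conn : connected_graph e.

Lemma dist_set_le u v (S : {set T}) : u \in S -> dist_set e v S <= dist e u v.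
Proof.
rewrite /dist_set => Su; have := mem_index_enum u.
elim: (index_enum T) => // w r IHr; rewrite inE big_cons.
case/predU1P=> [<- | ru]; first by rewrite Su geq_minl.
by case: ifP => _; [apply: leq_trans (geq_minr _ _) (IHr ru) | apply: IHr].
Qed.

Lemma dist_set_attained v (S : {set T}) :
  S != set0 -> exists2 u, u \in S & dist e u v = dist_set e v S.
Proof.
case/set0Pn=> u0 Su0.
(* For nonempty [S] this excludes the default value [#|T|] of the minimum. *)
have lt_T : dist_set e v S < #|T|.
  apply: leq_ltn_trans (dist_set_le v Su0) _.
  by have [p up <-] := upath_distP (e_conn u0 v); apply: upath_size up.
suff [|//] : dist_set e v S = #|T| \/ exists2 u, u \in S & dist e u v = dist_set e v S.
  by move=> E; rewrite E ltnn in lt_T.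
rewrite /dist_set; elim: (index_enum T) => [|w r IHr]; first by rewrite big_nil; left.
rewrite big_cons; case: ifP => // Sw; rewrite /minn; case: ifP => // _.
by right; exists w.
Qed.

Lemma path_ecc_leP u p k :
  reflect (forall v, exists2 w, w \in u :: p & dist e w v <= k) (path_ecc e u p <= k).
Proof.
apply: (iffP (bigmax_leqP _ _ _)) => [ecc_k v | cov v _].
  have [|w] := @dist_set_attained v [set z in u :: p].
    by apply/set0Pn; exists u; rewrite !inE eqxx.
  by rewrite inE => pw dw; exists w => //; rewrite dw ecc_k.
have [w pw dw] := cov v; apply: leq_trans dw.
by apply: dist_set_le; rewrite inE.
Qed.
End Eccentricity.

(** * From the metric argument back to paths in the graph *)

Lemma shortest_path_geodesic (T : finType) (e : rel T) s t p :
  symmetric e -> connected_graph e -> shortest_path e s t p ->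
  forall i j, i <= j <= size p -> dist e (nth s (s :: p) i) (nth s (s :: p) j) = j - i.
Proof.
move=> e_sym e_conn /andP[/and3P[ep /eqP lp _] /eqP sp].
have tri := dist_triangle e_conn; set Q := nth s (s :: p).
have le_dist i n : i + n <= size p -> dist e (Q i) (Q (i + n)) <= n.
  elim: n => [|n IHn]; first by rewrite addn0 dist_refl.
  rewrite addnS => lt_in; apply: leq_trans (tri _ (Q (i + n)) _) _.
  rewrite -[leqRHS]addn1 leq_add ?IHn ?(ltnW lt_in) // dist_edge //.
  by have /(pathP s) := ep; apply.
move=> i j /andP[le_ij le_j].
have Q0 : Q 0 = s by [].
have Qt : Q (size p) = t by rewrite -lp -nth_last /Q; case: (p).
(* The bounds for the three pieces add up to [dist e s t], so each of them is attained. *)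
have := le_dist 0 i; have := le_dist i (j - i); have := le_dist j (size p - j).
rewrite !subnKC // !add0n Q0 Qt.
move: (tri s (Q i) t) (tri (Q i) (Q j) t) sp le_ij le_j; clear; lia.
Qed.

Theorem theorem1 (T : finType) (e : rel T) (x y : T) (k : nat)
  (Gsimple : simple_graph e) (Gconn : connected_graph e)
  (Gdh : distance_hereditary e)
  (xy_diam : diametral e x y) (kmin : min_shortest_path_ecc e k) :
  exists p : seq T, shortest_path e x y p /\ path_ecc e x p = k.
Proof.
have [e_sym _] := Gsimple; have [[s [t [q [sp_q ecc_q]]]] k_le] := kmin.
have d_refl := dist_refl e; have d_eq0 := dist_eq0 Gconn; have d_sym := dist_sym e_sym Gconn.
have d_tri := dist_triangle Gconn; have d4 := dist_four_point e_sym Gconn Gdh.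
have geoQ := shortest_path_geodesic e_sym Gconn sp_q.
have covQ v : exists2 j, j <= size q & dist e v (nth s (s :: q) j) <= k.
  have /(path_ecc_leP Gconn)/(_ v)[w qw wk] : path_ecc e s q <= k by rewrite ecc_q.
  exists (index w (s :: q)); first by rewrite -ltnS index_mem.
  by rewrite nth_index // d_sym.
have diam_xy u v : dist e u v <= dist e x y.
  rewrite xy_diam; apply: leq_trans (leq_bigmax u).
  exact: (leq_bigmax (F := fun v => dist e u v)).
pose is_center i c := [&& dist e x c == i, dist e x c + dist e y c == dist e x y &
  [forall v, (dist e x v == i + k) ==> (dist e x v + dist e y v == dist e x y + 2 * k)
             ==> (dist e v c == k)]].
have ex_center i : i <= dist e x y -> exists c, is_center i c.
  move=> le_i; have [c0 xc0 yc0] := dist_between Gconn le_i.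
  have [||c [xc yc far]] := @slice_center T _ d_sym d_tri d4 k _ _ geoQ covQ x y diam_xy i c0.
  - by [].
  - by rewrite (d_sym y) xc0 yc0 subnKC.
  exists c; rewrite /is_center xc -xc yc !eqxx /=; apply/forallP=> v.
  by apply/implyP=> /eqP xv; apply/implyP=> /eqP yv; rewrite far -?xc.
(* The default [x] is returned only for [i] beyond [dist e x y]. *)
pose c i := odflt x [pick c | is_center i c].
have c_center i : i <= dist e x y -> is_center i (c i).
  by move=> /ex_center[c0 c0P]; rewrite /c; case: pickP => [//|/(_ c0)]; rewrite c0P.
have slice i : i <= dist e x y ->
    dist e x (c i) = i /\ dist e x (c i) + dist e y (c i) = dist e x y.
  by move=> /c_center/and3P[/eqP ? /eqP].
have far i v : i <= dist e x y -> dist e x v = i + k ->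
    dist e x v + dist e y v = dist e x y + 2 * k -> dist e v (c i) = k.
  move=> /c_center/and3P[_ _ /forallP/(_ v)] + xv yv.
  by rewrite yv xv !eqxx => /eqP.
have geo := slices_geodesic d_refl d4 slice.
have [c0 cD] := slices_ends d_eq0 d_sym slice.
have cov := slices_cover d_refl d_eq0 d_sym d_tri d4 geoQ covQ diam_xy slice far.
(* A path lists only the vertices after its start, hence [iota 1]; the start is [c 0 = x]. *)
have Ep : x :: map c (iota 1 (dist e x y)) = map c (iota 0 (dist e x y).+1).
  by rewrite /= c0.
exists (map c (iota 1 (dist e x y))).
have sp : shortest_path e x y (map c (iota 1 (dist e x y))).
  rewrite /shortest_path size_map size_iota eqxx andbT /upath Ep; apply/and3P; split.
  - apply/(pathP x) => i; rewrite size_map size_iota => lt_i; rewrite Ep.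
    rewrite !(nth_map 0) ?size_iota ?ltnS ?(ltnW lt_i) // !nth_iota ?ltnS ?(ltnW lt_i) //.
    by apply: (edge_dist1 Gconn); rewrite geo ?leqnSn // subSnn.
  - rewrite -(last_cons x) Ep -nth_last size_map size_iota (nth_map 0) ?size_iota //.
    by rewrite nth_iota // cD.
  rewrite map_inj_in_uniq ?iota_uniq // => i j; rewrite !mem_iota !add0n !ltnS /= => le_i le_j cij.
  by have [<- _] := slice i le_i; have [<- _] := slice j le_j; rewrite cij.
split=> //; apply/eqP; rewrite eqn_leq (k_le _ _ _ sp) andbT.
apply/(path_ecc_leP Gconn) => v; have [i le_i vi] := cov v.
by exists (c i); [rewrite Ep map_f // mem_iota | rewrite d_sym].
Qed.
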